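(* If two patterns $\pi$ and $\pi'$ of length $k$ are super-strongly c-forest-Wilf equivalent, then $\pi'=\pi$ or $\pi'=\overline\pi$.
   Context: A pattern of length $k$ is a permutation of $[k]$; its complement is $\overline\pi=(k+1-\pi(1))\cdots(k+1-\pi(k))$. Rooted forests are unordered, each component having a distinguished root. A consecutive instance of $\pi$ in a labeled rooted forest is a downward path of $k$ vertices $v_1,\dots,v_k$ ($v_i$ the parent of $v_{i+1}$) whose labels are in the same relative order as $\pi$. Patterns $\pi,\pi'$ of length $k$ are super-strongly c-forest-Wilf equivalent if for every unlabeled rooted forest $F$ on $n$ vertices and every set $S$ of downward paths of $k$ vertices in $F$, the number of ways to label the vertices of $F$ with distinct labels from $[n]$ such that $S$ is exactly the set of consecutive instances of $\pi$ equals the number of such labelings for which $S$ is exactly the set of consecutive instances of $\pi'$. *)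

(* Defs.v *)
From mathcomp Require Import all_boot all_order all_fingroup.
Set Implicit Arguments. Unset Strict Implicit. Unset Printing Implicit Defensive.

(* Complement: pi_bar(i) = k+1-pi(i) in 1-indexed terms, i.e. rev_ord (pi i)
   (= k-1-pi(i)) in 0-indexed terms. *)
Definition compl_pat (k : nat) (pi : 'S_k) : 'S_k :=
  perm (inj_comp (@rev_ord_inj k) (@perm_inj _ pi)).

(* A rooted forest on vertex set 'I_n: each vertex has an optional parent
   (roots have none) and following parents from any vertex reaches a root
   (no cycles).  Every unlabeled rooted forest on n vertices is represented
   by such a parent function on 'I_n (up to isomorphism). *)
Definition rooted_forest (n : nat) (par : 'I_n -> option 'I_n) : Prop :=
  forall v : 'I_n, exists m : nat, iter m (fun o => obind par o) (Some v) = None.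

Definition downward_path (n k : nat) (par : 'I_n -> option 'I_n)
    (t : k.-tuple 'I_n) : bool :=
  [forall i : 'I_k, forall j : 'I_k,
     (nat_of_ord j == (nat_of_ord i).+1) ==> (par (tnth t j) == Some (tnth t i))].

Definition order_iso (n k : nat) (pi : 'S_k) (sigma : 'S_n)
    (t : k.-tuple 'I_n) : bool :=
  [forall i : 'I_k, forall j : 'I_k,
     (sigma (tnth t i) < sigma (tnth t j))%N == (pi i < pi j)%N].

Definition is_instance (n k : nat) (par : 'I_n -> option 'I_n)
    (pi : 'S_k) (sigma : 'S_n) (t : k.-tuple 'I_n) : bool :=
  downward_path par t && order_iso pi sigma t.

Definition count_exact (n k : nat) (par : 'I_n -> option 'I_n)
    (S : {set k.-tuple 'I_n}) (pi : 'S_k) : nat :=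
  #|[set sigma : 'S_n | [forall t : k.-tuple 'I_n,
                           (t \in S) == is_instance par pi sigma t]]|.

Definition super_strongly_cfWilf_equiv (k : nat) (pi pi' : 'S_k) : Prop :=
  forall (n : nat) (par : 'I_n -> option 'I_n),
    rooted_forest par ->
    forall S : {set k.-tuple 'I_n},
      (forall t, t \in S -> downward_path par t) ->
      count_exact par S pi = count_exact par S pi'.

(* Main.v *)
(** By inclusion-exclusion, equivalent patterns give, for every set S of downward
    paths, the same number of labelings for which all paths of S are instances.
    Attach to such an S a fresh path whose top vertex v already lies on S and has
    the same rank s in each of these labelings: if the pattern starts with P
    entries below and Q above its first entry, and S spans s vertices below v and
    s' above, the number of labelings is multiplied by
    'C(s + P, P) * 'C(s' + Q, Q), up to a factor independent of the pattern.

    - Two paths with the same root determine the first entry up to complement.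
    - m paths starting at the i-th vertex of a path determine the i-th entry b
      through 'C(b + m P + P, P) * 'C(k - b + m Q + Q, Q) for all m; a comparison
      of roots in m recovers b if P <> Q, and b up to reflection if P = Q.
    - If P = Q, complementing makes the second entries agree, and a bundle of paths
      sharing two vertices together with one sharing vertices up to the first
      disagreement moves the rank of the root asymmetrically. *)

Require Import Defs.
From mathcomp Require Import all_boot all_order all_fingroup all_algebra zify ring.
Set Implicit Arguments. Unset Strict Implicit. Unset Printing Implicit Defensive.

(** * Counting labelings that increase along given sequences of vertices *)

Definition increasing_on (n : nat) (sigma : 'S_n) (s : seq 'I_n) : bool :=
  pairwise (fun u v => sigma u < sigma v) s.

Lemma increasing_on_perm_eq n (sigma : 'S_n) s1 s2 :
  increasing_on sigma s1 -> increasing_on sigma s2 -> perm_eq s1 s2 -> s1 = s2.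
Proof.
move=> h1 h2 e; apply: (inj_map (inj_comp (@ord_inj n) (@perm_inj _ sigma))).
apply: (@sorted_eq _ ltn ltn_trans).
- by move=> x y /andP[/ltn_trans xy /xy]; rewrite ltnn.
- by rewrite (sorted_pairwise ltn_trans) pairwise_map.
- by rewrite (sorted_pairwise ltn_trans) pairwise_map.
- exact: perm_map.
Qed.

Lemma increasing_on_exists n (sigma : 'S_n) s :
  uniq s -> exists2 z, perm_eq z s & increasing_on sigma z.
Proof.
move=> us; exists (sort (fun u v => sigma u <= sigma v) s); first by rewrite perm_sort.
set z := sort _ _.
have uz : uniq z by rewrite sort_uniq.
have: pairwise (fun u v => sigma u <= sigma v) z.
  rewrite -sorted_pairwise; last by move=> x y w; apply: leq_trans.
  by apply: sort_sorted => x y; apply: leq_total.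
move: uz; rewrite uniq_pairwise /increasing_on => uz hz.
have: pairwise [rel x y | (x != y) && (sigma x <= sigma y)] z by rewrite pairwise_relI uz hz.
apply: sub_pairwise => x y /= /andP[nxy le].
by rewrite ltn_neqAle le andbT; apply: contra nxy => /eqP /ord_inj /perm_inj ->.
Qed.

Lemma perm_of_perm_eq n (z y : seq 'I_n) :
  uniq z -> perm_eq y z ->
  exists p : 'S_n, [/\ map p z = y & forall x, x \notin z -> p x = x].
Proof.
move=> uz ezy; have uy : uniq y by rewrite (perm_uniq ezy).
have sz : size y = size z := perm_size ezy.
pose f x := if x \in z then nth x y (index x z) else x.
have fin x : x \in z -> f x \in z.
  by move=> xz; rewrite /f xz -(perm_mem ezy) mem_nth // sz index_mem.
have finj : injective f.
  move=> x1 x2; case h1: (x1 \in z); case h2: (x2 \in z).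
  - rewrite /f h1 h2 (set_nth_default x1 x2) ?sz ?index_mem // => /eqP.
    rewrite nth_uniq ?sz ?index_mem // => /eqP e.
    by rewrite -(nth_index x1 h1) e nth_index.
  - by move=> e; have := fin _ h1; rewrite e {1}/f h2 h2.
  - by move=> e; have := fin _ h2; rewrite -e {1}/f h1 h1.
  - by rewrite /f h1 h2.
exists (perm finj); split=> [|x hx]; last by rewrite permE /f (negPf hx).
have [z0|zpos] := posnP (size z).
  by rewrite (size0nil z0) (size0nil (etrans sz z0)).
have x0 : 'I_n by case: (z) zpos => // x.
apply: (@eq_from_nth _ x0) => [|i]; rewrite size_map ?sz // => hi.
rewrite (nth_map x0) // permE /f mem_nth // index_uniq //.
by apply: set_nth_default; rewrite sz.
Qed.

Lemma increasing_on_mulg n (p sigma : 'S_n) s :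
  increasing_on (p * sigma) s = increasing_on sigma (map p s).
Proof. by rewrite /increasing_on pairwise_map; apply: eq_pairwise => u v /=; rewrite !permM. Qed.

(** Each labeling sorts [s] in exactly one way. *)
Lemma card_sum_orderings n (C : {set 'S_n}) s : uniq s ->
  #|C| = \sum_(z <- permutations s) #|[set sigma in C | increasing_on sigma z]|.
Proof.
move=> us; under eq_bigr => z _ do rewrite -sum1dep_card big_mkcondr.
rewrite exchange_big /= -sum1_card; apply: eq_bigr => sigma _.
have [z0 z0s hz0] := increasing_on_exists sigma us.
rewrite -big_mkcond sum1_count.
have -> : 1 = count_mem z0 (permutations s).
  by rewrite (count_uniq_mem _ (permutations_uniq s)) mem_permutations z0s.
apply: eq_in_count => z; rewrite mem_permutations => zs /=.
apply/eqP/idP => [->//|hz]; apply: (increasing_on_perm_eq hz hz0).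
by rewrite (perm_trans zs) // perm_sym.
Qed.

(** Products of permutations apply the left factor first, so [p * sigma] is [sigma] with its labels
    rearranged within [s]. *)
Definition invariant_on (n : nat) (C : {set 'S_n}) (s : seq 'I_n) : Prop :=
  forall p sigma : 'S_n, (forall x, x \notin s -> p x = x) ->
    sigma \in C -> (p * sigma)%g \in C.

(** Precomposing with a permutation of the block carries the labelings sorted by one ordering to
    those sorted by any other, so all orderings of [s] are equally frequent in [C]. *)
Lemma card_increasing_on n (C : {set 'S_n}) s : uniq s -> invariant_on C s ->
  #|[set sigma in C | increasing_on sigma s]| * (size s)`! = #|C|.
Proof.
move=> us invC; rewrite (card_sum_orderings C us) -(size_permutations us).
rewrite -iter_addn_0 -count_predT -big_const_seq; apply: eq_big_seq => z.
rewrite mem_permutations => zs.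
have le y1 y2 : uniq y1 -> perm_eq y1 s -> perm_eq y2 s ->
    #|[set sigma in C | increasing_on sigma y1]| <=
    #|[set sigma in C | increasing_on sigma y2]|.
  move=> u1 y1s y2s.
  have u2 : uniq y2 by rewrite (perm_uniq y2s) -(perm_uniq y1s).
  have [||p [py pid]] := @perm_of_perm_eq _ y2 y1 => //.
    by rewrite (perm_trans y1s) // perm_sym.
  rewrite -(card_imset _ (mulgI p)); apply: subset_leq_card.
  apply/subsetP=> _ /imsetP[sigma + ->]; rewrite !inE => /andP[sC hs].
  rewrite increasing_on_mulg py hs andbT; apply: invC => // x.
  by rewrite -(perm_mem y2s); apply: pid.
by apply/eqP; rewrite eqn_leq !le // (perm_uniq zs).
Qed.

Lemma invariant_onT n s : @invariant_on n setT s.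
Proof. by move=> p sigma _; rewrite !inE. Qed.

Lemma card_increasing n (s : seq 'I_n) : uniq s ->
  #|[set sigma : 'S_n | increasing_on sigma s]| * (size s)`! = n`!.
Proof.
move=> us; rewrite -(card_Sn n) -cardsT -(card_increasing_on us (@invariant_onT n s)).
by congr (#|pred_of_set _| * _); apply/setP=> sigma; rewrite !inE.
Qed.

(* Both sides count C: a block may be sorted as a whole or in two halves. *)
Lemma card_increasing_on_merge n (C : {set 'S_n}) s1 s2 :
  uniq (s1 ++ s2) -> invariant_on C (s1 ++ s2) ->
  #|[set sigma in C | increasing_on sigma s1 & increasing_on sigma s2]|
     * ((size s1)`! * (size s2)`!) =
  #|[set sigma in C | increasing_on sigma (s1 ++ s2)]| * (size s1 + size s2)`!.
Proof.
move=> u12 invC; rewrite -size_cat card_increasing_on //.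
have /and3P[u1 /hasPn d12 u2] : [&& uniq s1, ~~ has (mem s1) s2 & uniq s2] by rewrite -cat_uniq.
have inv2 : invariant_on C s2.
  by move=> p sigma hp; apply: invC => x; rewrite mem_cat negb_or => /andP[_ /hp].
rewrite -(card_increasing_on u2 inv2).
set C2 := [set sigma in C | increasing_on sigma s2].
have inv1 : invariant_on C2 s1.
  move=> p sigma hp; rewrite !inE => /andP[sC hs]; apply/andP; split.
    by apply: invC => // x; rewrite mem_cat negb_or => /andP[/hp].
  rewrite increasing_on_mulg.
  suff /eq_in_map -> : {in s2, p =1 id} by rewrite map_id.
  by move=> x /d12 /hp.
rewrite -(card_increasing_on u1 inv1) mulnA; congr (#|pred_of_set _| * _ * _).
by apply/setP=> sigma; rewrite !inE -andbA [X in _ && X]andbC.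
Qed.

Lemma perm_eq_map_fix n (p : 'S_n) s :
  (forall x, x \notin s -> p x = x) -> uniq s -> perm_eq (map p s) s.
Proof.
move=> ps us; have um : uniq (map p s) by rewrite map_inj_uniq //; apply: perm_inj.
apply: uniq_perm => //.
have sub : {subset map p s <= s}.
  move=> _ /mapP[x xs ->]; apply/negPn/negP => pxs.
  by move: (pxs); rewrite (perm_inj (ps _ pxs)) xs.
by have [] := uniq_min_size um sub; rewrite ?size_map.
Qed.

Lemma invariant_onI n (C D : {set 'S_n}) s :
  invariant_on C s -> invariant_on D s -> invariant_on (C :&: D) s.
Proof.
by move=> hC hD p sigma ps; rewrite !in_setI => /andP[? ?]; rewrite hC ?hD.
Qed.

Lemma invariant_on_increasing n s s' : {in s', forall x, x \notin s} ->
  @invariant_on n [set sigma | increasing_on sigma s'] s.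
Proof.
move=> ss p sigma ps; rewrite !inE increasing_on_mulg.
suff /eq_in_map -> : {in s', p =1 id} by rewrite map_id.
by move=> x /ss /ps.
Qed.

(* The admissible sigma split the remaining elements between the two sides of v;
   on each side the two increasing blocks are merged independently. *)
Lemma card_increasing_two_chains n (z0 z1 y0 y1 : seq 'I_n) (v : 'I_n) :
  uniq ((z0 ++ y0) ++ v :: (z1 ++ y1)) ->
  #|[set sigma : 'S_n | increasing_on sigma (z0 ++ v :: z1)
       & increasing_on sigma (y0 ++ v :: y1)]|
    * ((size z0)`! * (size y0)`!) * ((size z1)`! * (size y1)`!)
    * (size z0 + size y0 + (size z1 + size y1)).+1`! =
  n`! * (size z0 + size y0)`! * (size z1 + size y1)`!.
Proof.
move=> u.
pose below s (sigma : 'S_n) := all (fun x => sigma x < sigma v) s.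
pose above s (sigma : 'S_n) := all (fun x => sigma v < sigma x) s.
have split_inc (sigma : 'S_n) s0 s1 : increasing_on sigma (s0 ++ v :: s1) =
   [&& below s0 sigma, above s1 sigma, increasing_on sigma s0 & increasing_on sigma s1].
  rewrite /below /above /increasing_on pairwise_cat /= allrel_consr.
  case b: (all (fun x => sigma x < sigma v) s0) => //=.
  case a: (all (fun x => sigma v < sigma x) s1); rewrite /= ?andbF //.
  suff -> : allrel (fun x y => sigma x < sigma y) s0 s1 by [].
  apply/allrelP => x y xs ys.
  exact: ltn_trans (allP b _ xs) (allP a _ ys).
have below_cat s1 s2 sigma : below (s1 ++ s2) sigma = below s1 sigma && below s2 sigma.
  exact: all_cat.
have above_cat s1 s2 sigma : above (s1 ++ s2) sigma = above s1 sigma && above s2 sigma.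
  exact: all_cat.
have : uniq (v :: (z0 ++ y0) ++ z1 ++ y1).
  by rewrite -(perm_uniq (permEl (perm_catCA _ [:: v] _))).
rewrite /= cat_uniq mem_cat negb_or => /andP[/andP[v0 v1] /and3P[u0 /hasPn d01 u1]].
have d10 : {in z0 ++ y0, forall x, x \notin z1 ++ y1}.
  by move=> x hx; apply/negP => /d01; rewrite /= hx.
(* [P] stands for either comparison with the label of [v]: rearranging the block [s] keeps [s]
   itself, and any block disjoint from it, on its side of [v]. *)
have move_block (p sigma : 'S_n) (s s' : seq 'I_n) (P : nat -> pred nat) :
    (forall x, x \notin s -> p x = x) -> uniq s -> v \notin s ->
    s' = s \/ {in s', forall x, x \notin s} ->
    all (fun x => P (sigma v) (sigma x)) s' ->
    all (fun x => P ((p * sigma)%g v) ((p * sigma)%g x)) s'.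
  move=> ps us vs; rewrite permM (ps v vs) => -[->|ss].
    rewrite -(perm_all _ (perm_eq_map_fix ps us)) all_map.
    by congr is_true; apply: eq_all => x /=; rewrite permM.
  by move=> /allP h; apply/allP => x xs'; rewrite permM ps ?ss //; apply: h.
pose C := [set sigma : 'S_n | below (z0 ++ y0) sigma & above (z1 ++ y1) sigma].
have invC s : uniq s -> v \notin s ->
    z0 ++ y0 = s \/ {in z0 ++ y0, forall x, x \notin s} ->
    z1 ++ y1 = s \/ {in z1 ++ y1, forall x, x \notin s} -> invariant_on C s.
  move=> us vs h0 h1 p sigma ps; rewrite !inE => /andP[hb ha].
  by rewrite /below /above (move_block _ _ s _ (fun x y => y < x)) //=
    (move_block _ _ s _ (fun x y => x < y)).
(* The lower blocks are merged inside [C0], where the upper ones are sorted separately; the upper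
   blocks are then merged inside [C1], where the lower ones are already merged. *)
pose C0 := C :&: ([set sigma | increasing_on sigma z1] :&: [set sigma | increasing_on sigma y1]).
pose C1 := C :&: [set sigma | increasing_on sigma (z0 ++ y0)].
have invC0 : invariant_on C0 (z0 ++ y0).
  apply: invariant_onI; first by apply: invC => //; [left | right].
  by apply: invariant_onI; apply: invariant_on_increasing => x xs;
    have := d01 x; rewrite mem_cat xs ?orbT => /(_ isT).
have invC1 : invariant_on C1 (z1 ++ y1).
  apply: invariant_onI; first by apply: invC => //; [right | left].
  exact: invariant_on_increasing.
have e1 := card_increasing_on_merge u1 invC1.
have e0 := card_increasing_on_merge u0 invC0.
have := card_increasing u; rewrite size_cat /= !size_cat addnS => <-.
have -> : [set sigma : 'S_n | increasing_on sigma ((z0 ++ y0) ++ v :: z1 ++ y1)] =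
    [set sigma in C1 | increasing_on sigma (z1 ++ y1)].
  by apply/setP=> sigma; rewrite !inE split_inc !andbA.
move: e0.
have -> : [set sigma in C0 | increasing_on sigma z0 & increasing_on sigma y0] =
    [set sigma : 'S_n | increasing_on sigma (z0 ++ v :: z1) & increasing_on sigma (y0 ++ v :: y1)].
  apply/setP=> sigma; rewrite !inE !split_inc below_cat above_cat.
  by do 2?[case: (below _ _) => //=]; do 2?[case: (above _ _) => //=]; do 4?[case: (increasing_on _ _) => //].
have -> : [set sigma in C0 | increasing_on sigma (z0 ++ y0)] =
    [set sigma in C1 | increasing_on sigma z1 & increasing_on sigma y1].
  apply/setP=> sigma; rewrite !inE.
  by do 1!case: (below _ _) => //=; do 1!case: (above _ _) => //=; do 3?[case: (increasing_on _ _) => //].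
move=> ->; rewrite [X in X * _ = _]mulnAC e1; move: _.+1`! => F.
by ring.
Qed.

(** * Attaching a chain of fresh vertices at a vertex of known rank *)

Lemma increasing_on_index n (sigma : 'S_n) z x y :
  increasing_on sigma z -> x \in z -> y \in z ->
  (sigma x < sigma y) = (index x z < index y z).
Proof.
move=> /(pairwiseP x) hz.
have lt u v : u \in z -> v \in z -> index u z < index v z -> sigma u < sigma v.
  move=> uz vz lt; rewrite -(nth_index x uz) -(nth_index x vz).
  by apply: hz; rewrite // inE index_mem.
move=> xz yz; case: (ltngtP (index x z) (index y z)) => [/lt->//|/lt h|e].
  by apply/negbTE; rewrite -leqNgt ltnW // h.
by rewrite -(nth_index x xz) e nth_index // ltnn.
Qed.

Lemma count_below_increasing n (sigma : 'S_n) z0 v z1 :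
  increasing_on sigma (z0 ++ v :: z1) ->
  count (fun u => sigma u < sigma v) (z0 ++ v :: z1) = size z0.
Proof.
rewrite /increasing_on pairwise_cat allrel_consr /= => /andP[/andP[h0 _] /and3P[_ h1 _]].
rewrite count_cat /= ltnn add0n.
have -> : count (fun u => sigma u < sigma v) z0 = size z0 by apply/eqP; rewrite -all_count.
rewrite [X in _ + X](_ : _ = 0) ?addn0 //; apply/eqP; rewrite eqn0Ngt -has_count -all_predC.
by apply: sub_all h1 => u /= vu; rewrite -leqNgt ltnW.
Qed.

Definition order_determined (n : nat) (X : {set 'S_n}) (T : seq 'I_n) : Prop :=
  forall sigma tau : 'S_n,
    {in T &, forall x y, (sigma x < sigma y) = (tau x < tau y)} ->
    sigma \in X -> tau \in X.

(** Classify by the ordering [z] of [T]: the labelings sorted by [z] lie in [X] all together or not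
    at all, and in the first case two chains crossing at [v] are counted. The factor does not depend
    on [z]. *)
Lemma card_attach_chain n (X : {set 'S_n}) (T y0 y1 : seq 'I_n) (v : 'I_n) (s : nat) :
  uniq T -> v \in T -> uniq (y0 ++ y1) -> {in y0 ++ y1, forall x, x \notin T} ->
  order_determined X T ->
  {in X, forall sigma : 'S_n, count (fun u => sigma u < sigma v) T = s} ->
  #|[set sigma in X | increasing_on sigma (y0 ++ v :: y1)]|
     * (s`! * (size y0)`!) * ((size T - s.+1)`! * (size y1)`!)
     * (size T + size y0 + size y1)`! =
  #|X| * (size T)`! * (s + size y0)`! * (size T - s.+1 + size y1)`!.
Proof.
move=> uT vT uy yT detX heightX.
rewrite (card_sum_orderings X uT) (card_sum_orderings [set sigma in X | _] uT).
rewrite !big_distrl /=; apply: eq_big_seq => z; rewrite mem_permutations => zT.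
have [A0|[sigma0]] := set_0Vmem [set sigma in X | increasing_on sigma z].
  rewrite A0 [X in #|pred_of_set X|](_ : _ = set0) ?cards0 //.
  apply/setP=> sigma; move/setP/(_ sigma): A0; rewrite !inE andbAC => /negbT.
  by rewrite negb_and => /orP[] /negPf ->; rewrite ?andbF.
rewrite inE => /andP[sX hz0].
have uz : uniq z by rewrite (perm_uniq zT).
have Xz (sigma : 'S_n) : increasing_on sigma z -> sigma \in X.
  move=> hz; apply: detX sX => x y; rewrite -!(perm_mem zT) => xz yz.
  by rewrite !(increasing_on_index _ xz yz).
have -> : [set sigma in X | increasing_on sigma z] = [set sigma | increasing_on sigma z].
  by apply/setP=> sigma; rewrite !inE andb_idl //; apply: Xz.
have -> : [set sigma in [set sigma in X | increasing_on sigma (y0 ++ v :: y1)] | increasing_on sigma z]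
   = [set sigma : 'S_n | increasing_on sigma z & increasing_on sigma (y0 ++ v :: y1)].
  by apply/setP=> sigma; rewrite !inE [in RHS]andbC; case h: (increasing_on _ z); rewrite ?andbF // Xz.
have szT := perm_size zT.
have := heightX _ sX; rewrite -(seq.permP zT).
have yz : {in y0 ++ y1, forall x, x \notin z} by move=> x /yT; rewrite (perm_mem zT).
move: vT; rewrite -(perm_mem zT) => vz.
move: hz0 uz szT yz; case/splitPr: vz => z0 z1 hz0 uz szT yz.
rewrite count_below_increasing // => zs.
have uall : uniq ((z0 ++ y0) ++ v :: z1 ++ y1).
  have /perm_uniq -> : perm_eq ((z0 ++ y0) ++ v :: z1 ++ y1) ((z0 ++ v :: z1) ++ y0 ++ y1).
    by apply/seq.permP => a; rewrite !count_cat /= !count_cat; lia.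
  by rewrite cat_uniq uz uy andbT; apply/hasPn.
have sz1 : size T - s.+1 = size z1 by rewrite -szT size_cat /= -zs; lia.
rewrite sz1 -!szT (card_increasing uz) -zs.
rewrite -(card_increasing_two_chains uall); congr (_ * _`!).
by rewrite size_cat /=; lia.
Qed.

(** * Labelings with at least the prescribed instances *)

Definition occurrence_set (n k : nat) (pi : 'S_k) (S : {set k.-tuple 'I_n}) : {set 'S_n} :=
  [set sigma | [forall (t | t \in S), order_iso pi sigma t]].

Definition superset_equiv (k : nat) (pi pi' : 'S_k) : Prop :=
  forall (n : nat) (par : 'I_n -> option 'I_n) (S : {set k.-tuple 'I_n}),
    rooted_forest par -> (forall t, t \in S -> downward_path par t) ->
    #|occurrence_set pi S| = #|occurrence_set pi' S|.

(** Sorting the labelings by their full instance set [D] reduces the count to exact counts, so the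
    equivalence passes to it term by term. *)
Lemma card_occurrence_set n k (par : 'I_n -> option 'I_n) (pi : 'S_k) (S : {set k.-tuple 'I_n}) :
  (forall t, t \in S -> downward_path par t) ->
  #|occurrence_set pi S| =
  \sum_(D : {set k.-tuple 'I_n} | (S \subset D) && (D \subset downward_path par))
     count_exact par D pi.
Proof.
move=> downS; pose inst (sigma : 'S_n) := [set t | is_instance par pi sigma t].
rewrite -sum1_card (partition_big inst
  (fun D : {set k.-tuple 'I_n} => (S \subset D) && (D \subset downward_path par))) /=.
  apply: eq_bigr => D /andP[SD _]; rewrite /count_exact -sum1dep_card.
  apply: eq_bigl => sigma; rewrite inE; apply/andP/forallP => [[_ /eqP <-] t|h].
    by rewrite inE.
  have eD : inst sigma = D by apply/setP=> t; rewrite inE -(eqP (h t)).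
  split; last exact/eqP.
  apply/forall_inP => t /(subsetP SD).
  by rewrite -eD inE => /andP[].
move=> sigma; rewrite inE => /forall_inP h; apply/andP; split; apply/subsetP => t.
  by move=> tS; rewrite inE /is_instance downS // h.
by rewrite inE => /andP[].
Qed.

Lemma super_strongly_superset_equiv k (pi pi' : 'S_k) :
  super_strongly_cfWilf_equiv pi pi' -> superset_equiv pi pi'.
Proof.
move=> h n par S fpar downS; rewrite !(card_occurrence_set _ downS).
apply: eq_bigr => D /andP[_ /subsetP downD]; by apply: h => // t /downD.
Qed.

Lemma compl_patE k (pi : 'S_k) i : compl_pat pi i = rev_ord (pi i).
Proof. by rewrite permE. Qed.

Lemma compl_pat_ltn k (pi : 'S_k) i j : (compl_pat pi i < compl_pat pi j) = (pi j < pi i).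
Proof. by rewrite !compl_patE /= ltn_sub2lE. Qed.

Lemma compl_patK k : involutive (@compl_pat k).
Proof. by move=> pi; apply/permP => i; rewrite !compl_patE rev_ordK. Qed.

(** Complementing all labels turns occurrences of a pattern into occurrences of its complement on
    the same paths. *)
Lemma superset_equiv_compl k (pi pi' : 'S_k) :
  superset_equiv pi pi' -> superset_equiv pi (compl_pat pi').
Proof.
move=> h n par S fpar downS; rewrite (h n par) //.
rewrite -(card_imset _ (can_inj (@compl_patK n))); congr (#|pred_of_set _|).
apply/setP=> sigma; apply/imsetP/idP => [[tau + ->]|hs].
  rewrite !inE => /forall_inP ht; apply/forall_inP => t /ht /forallP ho.
  apply/forallP => i; apply/forallP => j; rewrite !compl_pat_ltn.
  exact: (forallP (ho j)).
exists (compl_pat sigma); last by rewrite compl_patK.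
move: hs; rewrite !inE => /forall_inP ht; apply/forall_inP => t /ht /forallP ho.
apply/forallP => i; apply/forallP => j; rewrite compl_pat_ltn.
by have := forallP (ho j) i; rewrite compl_pat_ltn.
Qed.

(** * Instances of a pattern as increasing chains *)

Definition by_pattern (T : Type) (k : nat) (pi : 'S_k) (t : k.-tuple T) : seq T :=
  [seq tnth t ((pi^-1)%g x) | x <- enum 'I_k].

Lemma order_isoP n k (pi : 'S_k) (sigma : 'S_n) (t : k.-tuple 'I_n) :
  (forall i j, pi i < pi j -> sigma (tnth t i) < sigma (tnth t j)) ->
  order_iso pi sigma t.
Proof.
move=> lt; apply/forallP => i; apply/forallP => j; apply/eqP.
case: (ltngtP (pi i) (pi j)) => [/lt//|/lt ji|/ord_inj/perm_inj ->]; last exact: ltnn.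
by apply/negbTE; rewrite -leqNgt ltnW.
Qed.

Lemma order_iso_increasing n k (pi : 'S_k) (sigma : 'S_n) t :
  order_iso pi sigma t = increasing_on sigma (by_pattern pi t).
Proof.
have enum_lt : pairwise (fun i j : 'I_k => i < j) (enum 'I_k).
  by have := iota_ltn_sorted 0 k; rewrite (sorted_pairwise ltn_trans) -val_enum_ord pairwise_map.
rewrite /increasing_on pairwise_map; apply/idP/idP.
  move=> /forallP h; apply: sub_pairwise enum_lt => i j ij /=.
  by have /forallP/(_ ((pi^-1)%g j))/eqP -> := h ((pi^-1)%g i); rewrite !permKV.
move=> h.
have lt i j : pi i < pi j -> sigma (tnth t i) < sigma (tnth t j).
  move=> ij; have := ij.
  move/(pairwiseP i): h => /(_ (pi i) (pi j)) /=.
  by rewrite !inE size_enum_ord !ltn_ord !nth_ord_enum !permK; apply.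
exact: order_isoP lt.
Qed.

Lemma by_pattern_split (T : eqType) k (pi : 'S_k.+1) (t : k.+1.-tuple T) : uniq t ->
  exists y0 y1 : seq T,
    [/\ by_pattern pi t = y0 ++ tnth t ord0 :: y1, size y0 = pi ord0, size y1 = k - pi ord0,
        uniq (y0 ++ y1) & {in y0 ++ y1, forall x, exists2 i, i != ord0 & x = tnth t i}].
Proof.
move=> ut; set y := by_pattern pi t.
have sy : size y = k.+1 by rewrite size_map size_enum_ord.
have nthy i : nth (tnth t ord0) y (pi i) = tnth t i.
  by rewrite (nth_map ord0) ?size_enum_ord // nth_ord_enum permK.
have uy : uniq y.
  rewrite map_inj_uniq ?enum_uniq // => i j.
  by move/tuple_uniqP: ut => it /it /perm_inj.
exists (take (pi ord0) y), (drop (pi ord0).+1 y).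
have lt0 : pi ord0 < size y by rewrite sy.
have ey : y = take (pi ord0) y ++ tnth t ord0 :: drop (pi ord0).+1 y.
  by rewrite -{1}(nthy ord0) -drop_nth // cat_take_drop.
have := uy; rewrite {1}ey (perm_uniq (permEl (perm_catCA _ [:: _] _))) /= => /andP[n0 u01].
split=> //; [exact: size_takel (ltnW lt0) | by rewrite size_drop sy subSS |].
move=> x hx; have : x \in y by rewrite ey mem_cat in_cons orbCA -mem_cat hx orbT.
case/mapP => j _ ex; exists ((pi^-1)%g j) => //.
by apply: contraNneq n0 => e0; rewrite -[X in tnth t X]e0 -ex.
Qed.

(** An instance on [t] is a chain meeting [T] only in its top vertex, with [pi ord0] fresh vertices
    below and [k - pi ord0] above; the binomials count the merges with [T] on either side. *)
Lemma card_attach_pattern n k (pi : 'S_k.+1) (S : {set k.+1.-tuple 'I_n})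
    (T : seq 'I_n) (t : k.+1.-tuple 'I_n) (s : nat) :
  uniq T -> uniq t -> tnth t ord0 \in T ->
  (forall i, i != ord0 -> tnth t i \notin T) ->
  (forall u, u \in S -> forall i, tnth u i \in T) ->
  {in occurrence_set pi S, forall sigma : 'S_n,
     count (fun u => sigma u < sigma (tnth t ord0)) T = s} ->
  #|occurrence_set pi (t |: S)| * (size T + k)`! =
  #|occurrence_set pi S| * (size T)`! *
    ('C(s + pi ord0, pi ord0) * 'C(size T - s.+1 + (k - pi ord0), k - pi ord0)).
Proof.
move=> uT ut t0T tT ST height.
have [y0 [y1 [ey sy0 sy1 uy yt]]] := by_pattern_split pi ut.
have yT : {in y0 ++ y1, forall x, x \notin T} by move=> x /yt[i /tT ? ->].
have detX : order_determined (occurrence_set pi S) T.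
  move=> sigma tau st; rewrite !inE => /forall_inP h; apply/forall_inP => u uS.
  have /forallP hu := h u uS.
  apply/forallP => i; apply/forallP => j; have /forallP/(_ j) := hu i.
  by rewrite st // ST.
have := card_attach_chain uT t0T uy yT detX height; rewrite -ey sy0 sy1.
have -> : [set sigma in occurrence_set pi S | increasing_on sigma (by_pattern pi t)] =
    occurrence_set pi (t |: S).
  apply/setP=> sigma; rewrite !inE -order_iso_increasing.
  apply/andP/forall_inP => [[/forall_inP h ht] u|h].
    by rewrite !inE => /orP[/eqP -> //|/h].
  by rewrite h ?setU11 //; split=> //; apply/forall_inP => u uS; rewrite h // setU1r.
have -> : size T + pi ord0 + (k - pi ord0) = size T + k.
  by rewrite -addnA subnKC // -ltnS.
have /esym := @bin_fact (s + pi ord0) (pi ord0) (leq_addl _ _).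
have /esym := @bin_fact (size T - s.+1 + (k - pi ord0)) (k - pi ord0) (leq_addl _ _).
rewrite !addnK => -> -> h.
have pos : 0 < (s`! * (pi ord0)`!) * ((size T - s.+1)`! * (k - pi ord0)`!).
  by rewrite !muln_gt0 !fact_gt0.
apply/eqP; rewrite -(eqn_pmul2r pos); apply/eqP; move: h.
set a := _`!; set b := _`!; set c := _`!; set d := _`!; set e := _`!; set f := _`!.
move=> h; transitivity (#|occurrence_set pi (t |: S)| * (a * b) * (c * d) * e); first by ring.
by rewrite h; ring.
Qed.

(** * Forests and labelings obtained from rank functions *)

Lemma ranked_rooted_forest n (par : 'I_n -> option 'I_n) (rk : 'I_n -> nat) :
  (forall v u, par v = Some u -> rk u < rk v) -> rooted_forest par.
Proof.
move=> dec v; have [N] := ubnP (rk v); elim: N v => // N IH v ltN.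
case e: (par v) => [u|]; last by exists 1; rewrite /= e.
have [|M hM] := IH u; first by apply: leq_trans (dec _ _ e) _.
by exists M.+1; rewrite iterSr /= e.
Qed.

Lemma exists_monotone_perm n (g : 'I_n -> nat) :
  exists sigma : 'S_n, forall u v, g u < g v -> sigma u < sigma v.
Proof.
pose z := sort (fun u v => g u <= g v) (enum 'I_n).
have mz u : u \in z by rewrite mem_sort mem_enum.
have ltz u : index u z < n by rewrite -[X in _ < X]size_enum_ord -(size_sort (fun u v => g u <= g v)) index_mem.
have inj : injective (fun u => Ordinal (ltz u)).
  by move=> u v /(congr1 val) /= /(index_inj u); apply.
exists (perm inj) => u v uv; rewrite !permE /= ltnNge leq_eqVlt negb_or.
apply/andP; split.
  by apply: contraTneq uv => /(index_inj u (mz v) (mz u)) ->; rewrite ltnn.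
have tr : transitive (fun u v => g u <= g v) by move=> x y w; apply: leq_trans.
have so : sorted (fun u v => g u <= g v) z by apply: sort_sorted => x y; apply: leq_total.
by apply/negP => /(sorted_ltn_index tr so v u (mz v) (mz u)); rewrite leqNgt uv.
Qed.

Lemma card_pattern_below k (pi : 'S_k.+1) a : a <= k.+1 -> #|[set x | pi x < a]| = a.
Proof.
move=> ak; rewrite -sum1dep_card.
transitivity (\sum_(y < k.+1 | y < a) 1); first by rewrite [RHS](reindex_perm pi).
by rewrite -(big_ord_widen _ (fun=> 1) ak) sum1_card card_ord.
Qed.

(** * A spine with branches issuing from one vertex *)

Section Gadget.

Variables (k m : nat) (i0 : 'I_k.+1) (ln : 'I_m -> nat).
Hypothesis ln_gt0 : forall c, 0 < ln c.
(** Shared positions beyond the first carry the same index on spine and branch, so a branch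
    following the spine past [i0] must start where the spine starts. *)
Hypothesis shared_start : i0 = ord0 \/ forall c, ln c = 1.

(* A spine 'I_k.+1 and branches c, all starting at the spine vertex i0; branch c
   shares its first shared c vertices with the spine, and branch None is the one
   to be attached.  The vertices inr (c, x) with x < shared c lie on no branch. *)
Definition vertex : finType := ('I_k.+1 + option 'I_m * 'I_k.+1)%type.

Definition shared (c : option 'I_m) : nat := if c is Some c' then ln c' else 1.

Definition node (c : option 'I_m) (x : 'I_k.+1) : vertex :=
  if x < shared c then inl (if x == ord0 then i0 else x) else inr (c, x).

Definition parent (v : vertex) : option vertex :=
  match v with
  | inl x => if x == ord0 then None else Some (inl (inord x.-1))
  | inr (c, x) => if x == ord0 then None else Some (node c (inord x.-1))
  end.

Definition gadget_parent (v : 'I_#|vertex|) : option 'I_#|vertex| :=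
  omap enum_rank (parent (enum_val v)).

Definition spine : k.+1.-tuple 'I_#|vertex| := [tuple enum_rank (inl x : vertex) | x < k.+1].
Definition branch c : k.+1.-tuple 'I_#|vertex| := [tuple enum_rank (node c x) | x < k.+1].

Lemma shared_gt0 c : 0 < shared c.
Proof. by case: c => /=. Qed.

Lemma node0 c : node c ord0 = inl i0.
Proof. by rewrite /node shared_gt0 eqxx. Qed.

Lemma shared_start_eq c (x : 'I_k.+1) : x < shared c -> x != ord0 -> i0 = ord0.
Proof.
case: shared_start => // h1 lt /negP[]; apply/eqP/ord_inj/eqP.
by move: lt; rewrite -leqn0 -ltnS; case: c => [c|] //=; rewrite h1.
Qed.

Lemma node_shared c (x : 'I_k.+1) : x < shared c -> node c x = inl (if x == ord0 then i0 else x).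
Proof. by rewrite /node => ->. Qed.

Lemma node_inj c : injective (node c).
Proof.
move=> x y; rewrite /node.
have [hx|hx] := ltnP x (shared c); have [hy|hy] := ltnP y (shared c) => // -[//].
have [->|x0] := eqVneq x ord0; have [->|y0] := eqVneq y ord0 => // e.
  by rewrite -e (shared_start_eq hy y0).
by rewrite e (shared_start_eq hx x0).
Qed.

Definition rank_of (v : vertex) : nat :=
  match v with inl x => x | inr (_, x) => k.+1 + x end.

Lemma gadget_rooted : rooted_forest gadget_parent.
Proof.
apply: (@ranked_rooted_forest _ _ (fun v => rank_of (enum_val v))) => v u.
rewrite /gadget_parent; case: (enum_val v) => [x|[c x]] /=; case: eqP => //= /eqP x0 [<-];
  rewrite enum_rankK /=.
  rewrite inordK ?ltn_predL ?lt0n //; exact: leq_ltn_trans (leq_pred x) (ltn_ord x).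
have lt1 : x.-1 < k.+1 by apply: leq_ltn_trans (leq_pred x) (ltn_ord x).
rewrite /node; case: ifP => _ /=; first by apply: ltn_addr.
by rewrite inordK // ltn_add2l ltn_predL lt0n.
Qed.

Lemma spine_downward : downward_path gadget_parent spine.
Proof.
apply/forallP => i; apply/forallP => j; apply/implyP => /eqP ji.
rewrite !tnth_mktuple /gadget_parent enum_rankK /=.
have -> : (j == ord0) = false by apply/eqP => e; rewrite e in ji.
by rewrite ji /= inord_val.
Qed.

Lemma branch_downward c : downward_path gadget_parent (branch c).
Proof.
apply/forallP => i; apply/forallP => j; apply/implyP => /eqP ji.
have j0 : (j == ord0) = false by apply/eqP => e; rewrite e in ji.
rewrite !tnth_mktuple /gadget_parent enum_rankK {1}/node; case: ifP => hj /=.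
  rewrite j0 /= j0 ji /= inord_val; apply/eqP; congr (Some (enum_rank _)).
  rewrite node_shared; last by rewrite ltnW // -ji.
  by case: eqP => // ->; rewrite (shared_start_eq hj) ?j0.
by rewrite j0 ji /= inord_val.
Qed.

Definition base_chains : {set k.+1.-tuple 'I_#|vertex|} :=
  spine |: [set branch (Some c) | c : 'I_m].

Definition base_vertex (v : vertex) : bool :=
  match v with
  | inl _ => true
  | inr (Some c, x) => ln c <= x
  | inr (None, _) => false
  end.

Definition base_seq : seq 'I_#|vertex| := [seq enum_rank v | v <- enum base_vertex].

Lemma base_seq_uniq : uniq base_seq.
Proof. by rewrite map_inj_uniq ?enum_uniq //; apply: enum_rank_inj. Qed.

Lemma mem_base_seq v : (enum_rank v \in base_seq) = base_vertex v.
Proof. by rewrite mem_map ?mem_enum //; apply: enum_rank_inj. Qed.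

Lemma sum_vertex (F : vertex -> nat) :
  \sum_v F v = \sum_x F (inl x) + (\sum_c \sum_x F (inr (Some c, x)) + \sum_x F (inr (None, x))).
Proof.
rewrite big_sumType /=; congr (_ + _).
have -> : \sum_p F (inr p) = \sum_c \sum_x F (inr (c, x)).
  by rewrite pair_bigA; apply: eq_bigr => -[].
rewrite (bigD1 None) //= addnC; congr (_ + _).
by rewrite (reindex_omap Some id) /=; [apply: eq_bigl => c; rewrite eqxx | case].
Qed.

Definition gadget_size := k.+1 + \sum_c (k.+1 - ln c).

(** The rank of [i0] forced by the pattern: the spine puts [pi i0] vertices below it, and each
    branch, having [i0] as its top, adds its unshared vertices with entries below [pi ord0]. *)
Definition gadget_height (pi : 'S_k.+1) : nat :=
  pi i0 + \sum_(c < m) #|[set x : 'I_k.+1 | ln c <= x & pi x < pi ord0]|.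

Lemma size_base_seq : size base_seq = gadget_size.
Proof.
rewrite size_map -cardE -sum1_card big_mkcond /= sum_vertex /= big1_eq addn0.
rewrite sum1_card card_ord; congr (_ + _); apply: eq_bigr => c _.
rewrite -big_mkcond -(big_geq_mkord (ln c) k.+1 xpredT (fun=> 1)) sum_nat_const_nat.
by rewrite muln1.
Qed.

Lemma base_height (pi : 'S_k.+1) (sigma : 'S_#|vertex|) :
  sigma \in occurrence_set pi base_chains ->
  count (fun u => sigma u < sigma (enum_rank (inl i0 : vertex))) base_seq = gadget_height pi.
Proof.
rewrite inE => /forall_inP occ.
have occ_spine (x y : 'I_k.+1) :
    (sigma (enum_rank (inl x : vertex)) < sigma (enum_rank (inl y : vertex))) = (pi x < pi y).
  have /forallP/(_ x)/forallP/(_ y) := occ _ (setU11 _ _).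
  by rewrite !tnth_mktuple => /eqP.
have occ_branch c (x y : 'I_k.+1) :
    (sigma (enum_rank (node (Some c) x)) < sigma (enum_rank (node (Some c) y))) = (pi x < pi y).
  have /occ/forallP/(_ x)/forallP/(_ y) : branch (Some c) \in base_chains.
    by apply/setU1r/imset_f.
  by rewrite !tnth_mktuple => /eqP.
pose below (v : vertex) := match v with inl x => pi x < pi i0 | inr (_, x) => pi x < pi ord0 end.
rewrite /base_seq count_map (@eq_in_count _ _ below).
  rewrite -sum1_count big_enum_cond /= big_mkcond /= sum_vertex /= big1_eq addn0.
  congr (_ + _).
    by rewrite -big_mkcond sum1dep_card card_pattern_below // ltnW.
  apply: eq_bigr => c _; rewrite -big_mkcond -sum1dep_card.
  by apply: eq_bigl => x; rewrite unfold_in.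
move=> [x|[[c|] x]]; rewrite mem_enum unfold_in //= => cx.
have nx : node (Some c) x = inr (Some c, x) by rewrite /node ltnNge cx.
by rewrite -nx -(node0 (Some c)) occ_branch.
Qed.

Lemma base_occurrence_exists (pi : 'S_k.+1) :
  exists sigma : 'S_#|vertex|, sigma \in occurrence_set pi base_chains.
Proof.
(* The two shifts make spine and branch agree at [i0]; if more vertices are shared, then [i0 = ord0]
   and the shifts coincide. *)
pose g (v : vertex) := match v with inl x => pi x + pi ord0 | inr (_, x) => pi x + pi i0 end.
have [sigma mono] := exists_monotone_perm (fun v : 'I_#|vertex| => g (enum_val v)).
exists sigma; rewrite inE; apply/forall_inP => t.
case/setU1P => [->|/imsetP[c _ ->]]; apply: order_isoP => i j ij;
  apply: mono; rewrite /= !tnth_mktuple !enum_rankK /=; first by rewrite ltn_add2r.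
have gnode x : g (node (Some c) x) = pi x + pi i0.
  rewrite /node; case: ifP => //= lt; case: eqVneq => [->|x0]; first by rewrite addnC.
  by rewrite (@shared_start_eq (Some c) x lt x0).
by rewrite !gnode ltn_add2r.
Qed.

(** Both the base count and the count with branch [None] attached agree for the two patterns; the
    base count is nonzero, so their ratios can be compared. *)
Lemma gadget_identity (pi pi' : 'S_k.+1) : superset_equiv pi pi' ->
  'C(gadget_height pi + pi ord0, pi ord0) *
    'C(gadget_size - (gadget_height pi).+1 + (k - pi ord0), k - pi ord0) =
  'C(gadget_height pi' + pi' ord0, pi' ord0) *
    'C(gadget_size - (gadget_height pi').+1 + (k - pi' ord0), k - pi' ord0).
Proof.
move=> equiv.
have down t : t \in base_chains -> downward_path gadget_parent t.
  case/setU1P => [->|/imsetP[c _ ->]]; [exact: spine_downward | exact: branch_downward].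
have downU t : t \in branch None |: base_chains -> downward_path gadget_parent t.
  by case/setU1P => [->|/down//]; apply: branch_downward.
have attach (p : 'S_k.+1) : #|occurrence_set p (branch None |: base_chains)| * (size base_seq + k)`! =
    #|occurrence_set p base_chains| * (size base_seq)`! *
    ('C(gadget_height p + p ord0, p ord0) *
     'C(size base_seq - (gadget_height p).+1 + (k - p ord0), k - p ord0)).
  apply: card_attach_pattern.
  - exact: base_seq_uniq.
  - apply/tuple_uniqP => i j; rewrite !tnth_mktuple => /enum_rank_inj; exact: node_inj.
  - by rewrite tnth_mktuple mem_base_seq node0.
  - move=> i i0'; rewrite tnth_mktuple mem_base_seq /node ltnS leqn0.
    by rewrite (negPf (_ : i != 0 :> nat)).
  - move=> u /setU1P[->|/imsetP[c _ ->]] i; rewrite tnth_mktuple mem_base_seq //.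
    by rewrite /node; case: ltnP.
  - by move=> sigma; rewrite tnth_mktuple node0; apply: base_height.
rewrite -size_base_seq; apply/eqP.
have pos : 0 < #|occurrence_set pi base_chains| * (size base_seq)`!.
  rewrite muln_gt0 fact_gt0 andbT card_gt0; apply/set0Pn; exact: base_occurrence_exists.
rewrite -(eqn_pmul2l pos) -attach (equiv _ _ _ gadget_rooted downU) attach.
by rewrite (equiv _ _ _ gadget_rooted down).
Qed.

End Gadget.

(** * Products of binomials whose arguments have a fixed sum *)

Lemma product_spread (R : rel nat) (h : nat -> nat) :
  transitive R -> (forall x y, x < y -> R (h x * h y.+1) (h x.+1 * h y)) ->
  forall x y x' y', x < x' -> x' <= y' -> x + y = x' + y' -> R (h x * h y) (h x' * h y').
Proof.
move=> trR step x y x' y' xx' x'y' e.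
(* [e0 + 1] unit moves bring the arguments together from [(x, y)] to [(x', y')]; each is an
   [R]-step. *)
have [e0 ex'] : exists e0, x' = x.+1 + e0 by exists (x' - x.+1); rewrite subnKC.
have -> : y = (y' + e0).+1 by lia.
move: x'y'; rewrite {}ex'; elim: e0 x {xx' e} => [|e0 IH] x le; first by rewrite !addn0; apply: step; lia.
apply: trR (step x (y' + e0.+1) _) _; first by lia.
have -> : x.+1 + e0.+1 = x.+2 + e0 by lia.
by rewrite addnS; apply: IH; lia.
Qed.

Lemma product_spread_inj (R : rel nat) (h : nat -> nat) :
  transitive R -> irreflexive R -> (forall x y, x < y -> R (h x * h y.+1) (h x.+1 * h y)) ->
  forall x y x' y', x + y = x' + y' -> h x * h y = h x' * h y' -> x' = x \/ x' = y.
Proof.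
move=> trR irR step.
have sorted_case x y x' y' : x <= y -> x' <= y' -> x + y = x' + y' ->
    h x * h y = h x' * h y' -> x' = x.
  move=> xy x'y' e eh; have spread := product_spread trR step.
  case: (ltngtP x x') => [lt|lt|//].
    by have := spread x y x' y' lt x'y' e; rewrite eh irR.
  by have := spread x' y' x y lt xy (esym e); rewrite eh irR.
move=> x y x' y' e eh.
case/orP: (leq_total x y) => xy; case/orP: (leq_total x' y') => x'y'.
- by left; apply: sorted_case eh.
- have := sorted_case x y y' x' xy x'y' (etrans e (addnC _ _)) (etrans eh (mulnC _ _)); lia.
- by right; apply: (sorted_case y x x' y' xy x'y' (etrans (addnC _ _) e) (etrans (mulnC _ _) eh)).
- have := sorted_case y x y' x' xy x'y'; rewrite addnC e addnC mulnC eh mulnC => /(_ erefl erefl); lia.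
Qed.

(** Strict log-concavity: the ratio of consecutive values, [(z + 1 + p) / (z + 1)], decreases
    because [p] is positive. *)
Lemma binomial_product_inj p x y x' y' : 0 < p -> x + y = x' + y' ->
  'C(x + p, p) * 'C(y + p, p) = 'C(x' + p, p) * 'C(y' + p, p) -> x' = x \/ x' = y.
Proof.
move=> p0; apply: (@product_spread_inj ltn (fun x => 'C(x + p, p))) => {x y x' y'}.
- exact: ltn_trans.
- exact: ltnn.
move=> x y xy.
have rec z : (z.+1 + p) * 'C(z + p, p) = z.+1 * 'C(z.+1 + p, p).
  by have := mul_bin_down (z.+1 + p) p; rewrite addSn /= -addSn addnK.
have gt0 z : 0 < 'C(z + p, p) by rewrite bin_gt0 leq_addl.
have := rec x; have := rec y; have := gt0 x; have := gt0 y.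
move: 'C(x + p, p) 'C(y + p, p) 'C(x.+1 + p, p) 'C(y.+1 + p, p) => A B A' B' B0 A0 eB eA.
rewrite /ltn /= -(ltn_pmul2l (_ : 0 < x.+1 * y.+1)) //.
have -> : x.+1 * y.+1 * (A * B') = A * B * ((y.+1 + p) * x.+1).
  transitivity (x.+1 * A * (y.+1 * B')); first by ring.
  by rewrite -eB; ring.
have -> : x.+1 * y.+1 * (A' * B) = A * B * ((x.+1 + p) * y.+1).
  transitivity (y.+1 * B * (x.+1 * A')); first by ring.
  by rewrite -eA; ring.
by rewrite ltn_pmul2l ?muln_gt0 ?A0 //; nia.
Qed.

(** Strict log-convexity: the ratio of consecutive values, [2 (2 z + 1) / (z + 1)], increases,
    whence the reversed relation. *)
Lemma central_binomial_product_inj x y x' y' : x + y = x' + y' ->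
  'C(x + x, x) * 'C(y + y, y) = 'C(x' + x', x') * 'C(y' + y', y') -> x' = x \/ x' = y.
Proof.
apply: (@product_spread_inj (fun a b => b < a) (fun x => 'C(x + x, x))) => {x y x' y'}.
- by move=> x y z /= yx xz; apply: ltn_trans xz yx.
- exact: ltnn.
move=> x y xy.
have rec z : z.+1 * 'C(z.+1 + z.+1, z.+1) = 2 * (z + z).+1 * 'C(z + z, z).
  have /= := mul_bin_diag (z.+1 + z.+1) z.
  have /= := mul_bin_down (z + z).+1 z.
  have -> : z.+1 + z.+1 = (z + z).+2 by lia.
  have -> : (z + z).+1 - z = z.+1 by lia.
  move=> /= e1 e2; have : z.+1 * (z.+1 * 'C((z + z).+2, z.+1)) = z.+1 * (2 * (z + z).+1 * 'C(z + z, z)).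
    rewrite -e2 mulnCA addnS -e1.
    have -> : (z + z).+2 = 2 * z.+1 by lia.
    by ring.
  by move/eqP; rewrite eqn_pmul2l // => /eqP.
have gt0 z : 0 < 'C(z + z, z) by rewrite bin_gt0 leq_addl.
have := rec x; have := rec y; have := gt0 x; have := gt0 y.
move: 'C(x + x, x) 'C(y + y, y) 'C(x.+1 + x.+1, x.+1) 'C(y.+1 + y.+1, y.+1).
move=> A B A' B' B0 A0 eB eA.
rewrite /= -(ltn_pmul2l (_ : 0 < x.+1 * y.+1)) //.
have -> : x.+1 * y.+1 * (A * B') = A * B * (2 * (y + y).+1 * x.+1).
  transitivity (x.+1 * A * (y.+1 * B')); first by ring.
  by rewrite eB; ring.
have -> : x.+1 * y.+1 * (A' * B) = A * B * (2 * (x + x).+1 * y.+1).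
  transitivity (y.+1 * B * (x.+1 * A')); first by ring.
  by rewrite eA; ring.
by rewrite ltn_pmul2l ?muln_gt0 ?A0 //; nia.
Qed.

(** * Quotients of factorials as polynomials, and comparison of their roots *)

Lemma fact_add_prod n d : (n + d)`! = n`! * \prod_(i < d) (n + i.+1).
Proof.
elim: d => [|d IH]; first by rewrite addn0 big_ord0 muln1.
by rewrite big_ord_recr /= addnS factS IH; ring.
Qed.

Section Roots.

Import GRing.Theory Num.Theory.
Local Open Scope ring_scope.

Lemma poly_eq0_nat (p : {poly rat}) : (forall m : nat, p.[m%:R] = 0) -> p = 0.
Proof.
move=> h; apply: (@roots_geq_poly_eq0 _ p [seq m%:R | m <- iota 0 (size p)]).
- by apply/allP => _ /mapP[m _ ->]; apply/rootP.
- by rewrite map_inj_uniq ?iota_uniq // => x y /eqP; rewrite eqr_nat => /eqP.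
- by rewrite size_map size_iota.
Qed.

(** Both sides are polynomials in [m] agreeing at all natural numbers, so the root
    [- (B + i + 1) / Q] of a left factor annuls some right factor. *)
Lemma product_roots_match (d P Q b B c1 c2 : nat) : (0 < c2)%N -> (0 < Q)%N ->
  (forall m, c1 * \prod_(i < d) (B + m * Q + i.+1) = c2 * \prod_(i < d) (b + m * P + i.+1))%N ->
  forall i : 'I_d, exists j : 'I_d, (P * (B + i.+1) = Q * (b + j.+1))%N.
Proof.
move=> c20 Q0 h i.
pose F (a R c : nat) : {poly rat} := c%:R *: \prod_(i < d) ((a + i.+1)%:R%:P + R%:R *: 'X).
have FE a R c x : (F a R c).[x] = c%:R * \prod_(i < d) ((a + i.+1)%:R + R%:R * x).
  by rewrite hornerZ horner_prod; congr (_ * _); apply: eq_bigr => j _; rewrite !hornerE.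
have Fnat a R c m : (F a R c).[m%:R] = (c * \prod_(i < d) (a + m * R + i.+1))%N%:R.
  rewrite FE natrM natr_prod; congr (_ * _); apply: eq_bigr => j _.
  by rewrite -natrM -natrD; congr (_%:R); lia.
have e : F B Q c1 = F b P c2.
  by apply/eqP; rewrite -subr_eq0; apply/eqP/poly_eq0_nat => m; rewrite hornerD hornerN !Fnat h subrr.
have Qn0 : Q%:R != 0 :> rat by rewrite pnatr_eq0 -lt0n.
pose x : rat := - (B + i.+1)%:R / Q%:R.
have Qx : Q%:R * x = - (B + i.+1)%:R by rewrite /x mulrCA divff // mulr1.
have : (F b P c2).[x] = 0 by rewrite -e FE (bigD1 i) //= Qx subrr mul0r mulr0.
rewrite FE => /eqP; rewrite mulf_eq0 pnatr_eq0 eqn0Ngt c20 /= => /prodf_eq0[j _ /eqP ej].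
exists j; apply/eqP; rewrite -(eqr_nat rat) !natrM eq_sym -subr_eq0; apply/eqP.
by rewrite -mulrN -Qx mulrCA -mulrDr ej mulr0.
Qed.

End Roots.

(* Comparing the extreme roots in m of the two sides of the telescoped identity
   gives P = Q unless b' and b are adjacent, and then k.+1 would divide b'. *)
Lemma binomial_products_inj (k P Q b b' : nat) :
  P + Q = k -> P <> Q -> b <= k -> b' <= k ->
  (forall m, 'C(b + m * P + P, P) * 'C(k - b + m * Q + Q, Q) =
             'C(b' + m * P + P, P) * 'C(k - b' + m * Q + Q, Q)) -> b = b'.
Proof.
move=> PQ nPQ.
wlog lt : b b' / b < b'.
  move=> H bk b'k h; case: (ltngtP b b') => // lt; first exact: H.
  by apply/esym/H.
move=> bk b'k h; exfalso.
have fact_step a R : (a + R)`! = 'C(a + R, R) * (R`! * a`!).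
  by rewrite -(@bin_fact (a + R) R (leq_addl _ _)) addnK.
(* Each binomial is, up to a constant, a quotient of factorials at consecutive [m], so the product
   of the hypotheses below [m] telescopes. *)
have tele m : (b + m * P)`! * (k - b + m * Q)`! * (b'`! * (k - b')`!) =
              (b' + m * P)`! * (k - b' + m * Q)`! * (b`! * (k - b)`!).
  elim: m => [|m IH]; first by rewrite !addn0; ring.
  have succ a R : a + m.+1 * R = a + m * R + R by rewrite mulSn addnA addnAC.
  rewrite !succ (fact_step (b + m * P)) (fact_step (k - b + m * Q)).
  rewrite (fact_step (b' + m * P)) (fact_step (k - b' + m * Q)).
  move: IH (h m); move: 'C(_,_) 'C(_,_) 'C(_,_) 'C(_,_) => c1 c2 c3 c4 IH hm.
  transitivity (c4 * c3 * (P`! * Q`!) *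
    ((b + m * P)`! * (k - b + m * Q)`! * (b'`! * (k - b')`!))); first by ring.
  by rewrite IH hm; ring.
pose d := b' - b; pose B := k - b'.
have eb' : b' = b + d by rewrite /d; lia.
have eB : k - b = B + d by rewrite /B /d; lia.
have d0 : 0 < d by rewrite subn_gt0.
pose K1 := b'`! * B`!; pose K2 := b`! * (k - b)`!.
have prods m : K1 * \prod_(i < d) (B + m * Q + i.+1) = K2 * \prod_(i < d) (b + m * P + i.+1).
  have pos : 0 < (b + m * P)`! * (B + m * Q)`! by rewrite muln_gt0 !fact_gt0.
  apply/eqP; rewrite -(eqn_pmul2l pos); apply/eqP; have := tele m.
  rewrite -/B -/K1 -/K2 [in X in X -> _]eb' eB (addnAC b) (addnAC B) !(fact_add_prod _ d) => t.
  transitivity ((b + m * P)`! * ((B + m * Q)`! * \prod_(i < d) (B + m * Q + i.+1)) * K1); first by ring.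
  by rewrite t; ring.
have K10 : 0 < K1 by rewrite muln_gt0 !fact_gt0.
have K20 : 0 < K2 by rewrite muln_gt0 !fact_gt0.
have rQ : 0 < Q -> forall i : 'I_d, exists j : 'I_d, P * (B + i.+1) = Q * (b + j.+1).
  by move=> Q0; apply: product_roots_match K20 Q0 prods.
have rP : 0 < P -> forall i : 'I_d, exists j : 'I_d, Q * (b + i.+1) = P * (B + j.+1).
  by move=> P0; apply: product_roots_match K10 P0 (fun m => esym (prods m)).
have Q0 : 0 < Q.
  rewrite lt0n; apply/eqP => Q0; have P0 : 0 < P by lia.
  by have [j] := rP P0 (Ordinal d0); rewrite Q0; nia.
have P0 : 0 < P.
  rewrite lt0n; apply/eqP => P0.
  by have [j] := rQ Q0 (Ordinal d0); rewrite P0; nia.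
(* Matching roots in both directions bounds the smallest ones both ways; the largest ones give
   [last_root] likewise. *)
have first_root : P * B.+1 = Q * b.+1.
  have [j1 e1] := rQ Q0 (Ordinal d0); have [j2 e2] := rP P0 (Ordinal d0).
  by move: e1 e2 => /=; rewrite !addn1; nia.
have ltd : d.-1 < d by rewrite prednK.
have last_root : P * (B + d) = Q * (b + d).
  have [j1 e1] := rQ Q0 (Ordinal ltd); have [j2 e2] := rP P0 (Ordinal ltd).
  move: e1 e2 (ltn_ord j1) (ltn_ord j2) => /=; rewrite prednK // => e1 e2 l1 l2.
  by apply/eqP; rewrite eqn_leq {1}e1 {2}e2 !leq_pmul2l // !leq_add2l l1 l2.
(* The difference of the two root equations is [P * (d - 1) = Q * (d - 1)], with [P <> Q]. *)
have d1 : d = 1 by nia.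
(* Here [B + 1 = k - b]; adding [P * (b + 1)] to both sides of [first_root] gives
   [P * (k + 1) = k * (b + 1)], while [0 < b + 1 <= k]. *)
have : k.+1 %| k * b.+1.
  by apply/dvdnP; exists P; move: first_root; rewrite /B eb' d1; nia.
rewrite Gauss_dvdr; last by rewrite coprimeSn.
by move=> /dvdn_leq; rewrite ltnS; lia.
Qed.

(** * Recovering the pattern from the gadget identities *)

Lemma superset_equiv_start k (pi pi' : 'S_k.+1) : superset_equiv pi pi' ->
  pi' ord0 = pi ord0 \/ pi' ord0 = k - pi ord0 :> nat.
Proof.
move=> equiv.
(* Two paths sharing only their root give central binomials with arguments summing to [k]. *)
have := gadget_identity (m := 0) (i0 := ord0) (ln := fun=> 1) (fun=> isT) (or_introl erefl) equiv.
rewrite /gadget_height /gadget_size !big_ord0 !addn0 !subSS => e.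
have p0 := ltn_ord (pi ord0); have p0' := ltn_ord (pi' ord0).
have [] := central_binomial_product_inj _ e; [lia | by left; apply/ord_inj | by right].
Qed.

Lemma superset_equiv_value k (pi pi' : 'S_k.+1) : superset_equiv pi pi' ->
  pi' ord0 = pi ord0 -> forall (i : 'I_k.+1) m,
  'C(pi i + m * pi ord0 + pi ord0, pi ord0) *
    'C(k - pi i + m * (k - pi ord0) + (k - pi ord0), k - pi ord0) =
  'C(pi' i + m * pi ord0 + pi ord0, pi ord0) *
    'C(k - pi' i + m * (k - pi ord0) + (k - pi ord0), k - pi ord0).
Proof.
move=> equiv e0 i m.
(* Each of the [m] branches at [i] adds [pi ord0] vertices below it and [k - pi ord0] above. *)
have := gadget_identity (m := m) (i0 := i) (ln := fun=> 1) (fun=> isT) (or_intror (fun=> erefl)) equiv.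
have height (p : 'S_k.+1) : gadget_height i (fun _ : 'I_m => 1) p = p i + m * p ord0.
  rewrite /gadget_height sum_nat_const card_ord; congr (_ + _ * _).
  rewrite -[RHS](card_pattern_below p (ltnW (ltn_ord (p ord0)))).
  apply: eq_card => x; rewrite !inE lt0n andb_idl //.
  by apply: contraTneq => x0; rewrite (_ : x = ord0) ?ltnn //; apply/ord_inj.
have room (p : 'S_k.+1) : gadget_size k (fun _ : 'I_m => 1) - (p i + m * p ord0).+1
    = k - p i + m * (k - p ord0).
  rewrite /gadget_size sum_nat_const card_ord subn1 /=.
  by have := ltn_ord (p i); have := ltn_ord (p ord0); rewrite mulnBr; nia.
by rewrite !height !room e0.
Qed.

Lemma gadget_height_lt k m (i0 : 'I_k.+1) (ln : 'I_m -> nat) (pi : 'S_k.+1) :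
  gadget_height i0 ln pi < gadget_size k ln.
Proof.
rewrite /gadget_height /gadget_size -addSn leq_add ?ltn_ord //.
apply: leq_sum => c _; rewrite -sum1dep_card.
rewrite -[X in _ <= X]muln1 -sum_nat_const_nat (big_geq_mkord _ _ xpredT).
rewrite [X in X <= _]big_mkcond [X in _ <= X]big_mkcond; apply: leq_sum => x _ /=.
by case: (ln c <= x); case: (pi x < _).
Qed.

(* Gadget: r branches share two vertices with the spine and one shares j + 1, j
   being the first disagreement.  The heights of the root differ for the two
   patterns, and for large r they are not mirror images either. *)
Lemma superset_equiv_middle k (pi pi' : 'S_k.+1) (i1 : 'I_k.+1) :
  superset_equiv pi pi' -> k = 2 * pi ord0 -> 0 < pi ord0 -> i1 = 1 :> nat ->
  pi' ord0 = pi ord0 -> pi' i1 = pi i1 ->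
  (forall i, pi' i = pi i \/ pi' i = k - pi i :> nat) -> pi' = pi.
Proof.
move=> equiv ek p0 ei1 e0 e1 dich; set p : nat := pi ord0.
apply/eqP/negPn/negP => neq.
have [j0 nj0] : exists j, pi' j != pi j.
  apply/existsP; apply: contraNT neq; rewrite negb_exists => /forallP h.
  by apply/eqP/permP => x; apply/eqP; rewrite -[_ == _]negbK h.
case: (@arg_minnP _ j0 (fun j => pi' j != pi j) (fun j => j : nat) nj0) => j nj minj {j0 nj0 neq}.
have agree (x : 'I_k.+1) : x < j -> pi' x = pi x.
  by move=> xj; apply/eqP; apply: contraLR xj; rewrite -leqNgt; apply: minj.
have j2 : 1 < j.
  case: (ltngtP j 1) => // jlt; case/negP: nj; apply/eqP.
    by rewrite (_ : j = ord0) //; apply/ord_inj/eqP; rewrite -leqn0 -ltnS.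
  by rewrite (_ : j = i1) //; apply/ord_inj; rewrite jlt.
pose r := k.+1; pose ln (c : 'I_r.+1) := if c == ord0 then j.+1 else 2.
have ln0 c : 0 < ln c by rewrite /ln; case: eqP.
have := gadget_identity (i0 := ord0) ln0 (or_introl erefl) equiv.
pose U (q : 'S_k.+1) l := #|[set x : 'I_k.+1 | l <= x & q x < q ord0]|.
have height (q : 'S_k.+1) : gadget_height ord0 ln q = q ord0 + (U q j.+1 + r * U q 2).
  rewrite /gadget_height big_ord_recl {1}/ln eqxx; congr (_ + (_ + _)).
  by rewrite -[X in X * _]card_ord -sum_nat_const; apply: eq_bigr.
have size_eq : gadget_size k ln = k.+1 + (k - j + r * (k - 1)).
  rewrite /gadget_size big_ord_recl {1}/ln eqxx subSS; congr (_ + (_ + _)).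
  by rewrite -[X in X * _]card_ord -sum_nat_const; apply: eq_bigr => c _; rewrite /ln /= subSS.
have kp : k - p = p by rewrite /p; lia.
rewrite e0 -/p kp => e.
have h := gadget_height_lt ord0 ln pi; have h' := gadget_height_lt ord0 ln pi'.
(* Agreement before [j] is visible on the positions before the cut; [L] and [U] are complementary
   counts. *)
pose L (q : 'S_k.+1) l := #|[set x : 'I_k.+1 | x < l & q x < q ord0]|.
have LU (q : 'S_k.+1) l : L q l + U q l = q ord0.
  rewrite -[RHS](card_pattern_below q (ltnW (ltn_ord _))).
  rewrite /L /U -[RHS](cardsID [set x : 'I_k.+1 | x < l]); congr (_ + _).
    by apply: eq_card => x; rewrite !inE andbC.
  by apply: eq_card => x; rewrite !inE -leqNgt.
have L_agree l : l <= j -> L pi' l = L pi l.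
  move=> lj; apply: eq_card => x; rewrite !inE e0; case: ltnP => //= xl.
  by rewrite agree // (leq_trans xl).
have L_succ (q : 'S_k.+1) : L q j.+1 = (q j < q ord0) + L q j.
  rewrite /L (cardsD1 j) inE leqnn /=; congr (_ + _); apply: eq_card => x.
  rewrite !inE ltnS [x <= j]leq_eqVlt; case: eqVneq => [->|nx] /=; first by rewrite ltnn.
  by rewrite (inj_eq val_inj) (negPf nx).
have A_eq : U pi' 2 = U pi 2 by have := LU pi 2; have := LU pi' 2; rewrite e0 (L_agree 2 j2); lia.
(* [pi j] and [k - pi j] are distinct, hence on opposite sides of [p = k / 2], so exactly one of the
   patterns counts [j] in [L]. *)
have D_neq : U pi' j.+1 != U pi j.+1.
  have := LU pi j.+1; have := LU pi' j.+1; rewrite !L_succ e0 (L_agree j (leqnn j)).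
  have : pi' j = k - pi j :> nat by case: (dich j) => // e'; rewrite e' eqxx in nj.
  have := nj; rewrite -(inj_eq val_inj) /=.
  have := ltn_ord (pi j).
  move: (U pi' _) (U pi _) (L pi j) => u' u l lt /eqP; rewrite -/p.
  move: (nat_of_ord (pi' j)) (nat_of_ord (pi j)) lt => b' b lt ne hb.
  rewrite -/p in ek; case: (ltngtP b' p); case: (ltngtP b p); lia.
have := binomial_product_inj p0 _ e; case; [lia | |].
  by rewrite !height e0 A_eq; move/eqP: D_neq; lia.
have Dle q : U q j.+1 <= q ord0 by rewrite -(LU q j.+1) leq_addl.
have := Dle pi; have := Dle pi'; have := ltn_ord j; move: h h'.
rewrite size_eq !height e0 A_eq -/p.
(* In the mirror case the heights sum to [gadget_size - 1], that is,
   [r * (2 A - (k - 1)) = k - j - D - D']. As [k - 1 = 2 p - 1] is odd, the left side has absolute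
   value at least [r = k + 1], but the right side lies between [- k] and [k]. *)
move: (U pi' _) (U pi j.+1) (U pi 2) => D' D A.
rewrite -/p in ek.
have rk : r * (k - 1) + r = r * p + r * p.
  by rewrite -mulnSr -mulnDr; congr (_ * _); lia.
have [Ap|pA] := ltnP A p.
  have : r * A.+1 <= r * p by rewrite leq_mul2l Ap orbT.
  by rewrite mulnS /r in rk *; lia.
have : r * p <= r * A by rewrite leq_mul2l pA orbT.
by rewrite /r in rk *; lia.
Qed.

Lemma superset_equiv_same_start k (pi pi' : 'S_k.+1) :
  superset_equiv pi pi' -> pi' ord0 = pi ord0 -> pi' = pi \/ pi' = compl_pat pi.
Proof.
move=> equiv e0; have value := superset_equiv_value equiv e0.
have le_k (q : 'S_k.+1) i : q i <= k by rewrite -ltnS.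
have [mid|nmid] := eqVneq (pi ord0 : nat) (k - pi ord0); last first.
  left; apply/permP => i; apply/ord_inj/esym.
  apply: (@binomial_products_inj k (pi ord0) (k - pi ord0)) => //; first exact: subnKC.
  exact/eqP.
have ek : k = 2 * pi ord0 by have := le_k pi ord0; lia.
have [k0|kpos] := posnP k.
  left; apply/permP => i; apply/ord_inj.
  by have := le_k pi i; have := le_k pi' i; lia.
have p0 : 0 < pi ord0 by lia.
(* For equal parameters the case [m = 0] already gives each entry up to reflection. *)
have dich i : pi' i = pi i \/ pi' i = k - pi i :> nat.
  have := value i 0; rewrite -mid !addn0 => /(binomial_product_inj p0).
  have := le_k pi i; have := le_k pi' i => h' h.
  by case; [lia | left; apply/ord_inj | right].
pose i1 : 'I_k.+1 := inord 1.
have ei1 : i1 = 1 :> nat by rewrite inordK.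
case: (dich i1) => e1; first by left; apply: (superset_equiv_middle equiv ek p0 ei1).
(* The first entry is the middle value, fixed by complementation; the reflected second entry now
   agrees as well. *)
right; rewrite -[pi']compl_patK; congr compl_pat.
apply: (superset_equiv_middle (superset_equiv_compl equiv) ek p0 ei1).
- by apply/ord_inj; rewrite compl_patE e0 /= subSS -mid.
- by apply/ord_inj; rewrite compl_patE /= subSS e1 subKn.
move=> i; case: (dich i) => e; [right | left; apply/ord_inj];
  by rewrite compl_patE /= subSS e ?subKn.
Qed.

Theorem theorem1p7 (k : nat) (pi pi' : 'S_k) :
  super_strongly_cfWilf_equiv pi pi' ->
  pi' = pi \/ pi' = compl_pat pi.
Proof.
move=> /super_strongly_superset_equiv.
case: k pi pi' => [|k] pi pi' equiv; first by left; apply/permP => -[].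
case: (superset_equiv_start equiv) => e0.
  by apply: superset_equiv_same_start => //; apply/ord_inj.
(* A reflected first entry is repaired by passing to the complement of [pi'], again equivalent to
   [pi]. *)
have c0 : compl_pat pi' ord0 = pi ord0.
  by apply/ord_inj; rewrite compl_patE /= subSS e0 subKn // -ltnS.
have [e|e] := superset_equiv_same_start (superset_equiv_compl equiv) c0; [right | left];
  by rewrite -[LHS]compl_patK e ?compl_patK.
Qed.
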